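(* Let $A_5(n)$ be defined by $\sum_{n\ge 0}A_5(n)q^n=\dfrac{f_5^{10}}{f_1^2}$, and let $\{B_k\}_{k\ge 0}$ be defined by $B_0=0$, $B_1=1$ and $B_k=-4B_{k-1}-8B_{k-2}+\dfrac{8^k-1}{7}$ for $k\ge 2$. Then for all integers $n\ge 0$ and $k\ge 1$, \[ A_5(2^{k+1}n+3\cdot 2^k-2) = B_kA_5(4n+4)+\left(\frac{8^{k+1}-1}{7}-9B_k\right)A_5(2n+1). \] Consequently, for all integers $m\ge0$ and $n\ge 0$, \[ A_5(2^{4m+4}n+3\cdot 2^{4m+3}-2)\equiv 0\pmod{\frac{8^{4m+4}-1}{91}}. \]
   Context: For $m\in\mathbb{N}$ and $|q|<1$, $f_m:=\prod_{n\ge1}(1-q^{mn})$. $A_5(n)$ is the number of partition pairs of $n$ with $5$-cores; its generating function is $\sum_{n\ge0}A_5(n)q^n=f_5^{10}/f_1^2$. *)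

(* Defs.v *)
From mathcomp Require Import all_boot all_order all_algebra.
Set Implicit Arguments. Unset Strict Implicit. Unset Printing Implicit Defensive.
Import GRing.Theory Num.Theory.
Local Open Scope ring_scope.

Definition f_trunc (N m : nat) : {poly int} :=
  \prod_(1 <= j < N.+1) (1 - 'X^(m * j)).

Definition geom_trunc (N j : nat) : {poly int} :=
  \sum_(0 <= i < N.+1) 'X^(j * i).

Definition invf1_trunc (N : nat) : {poly int} :=
  \prod_(1 <= j < N.+1) geom_trunc N j.

(* A_5(n) = coefficient of q^n in f_5^10 / f_1^2.  Factors with j > n and
   terms of degree > n do not contribute to the coefficient of q^n, so
   truncating at N = n computes it exactly. *)
Definition A5 (n : nat) : int :=
  ((f_trunc n 5) ^+ 10 * (invf1_trunc n) ^+ 2)`_n.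

Fixpoint B (k : nat) : int :=
  match k with
  | 0 => 0
  | k1.+1 =>
    match k1 with
    | 0 => 1
    | k'.+1 => -4 * B k1 - 8 * B k' + (((8 ^ k'.+2 - 1) %/ 7)%N)%:Z
    end
  end.

(* Main.v *)
From HB Require Import structures.
Require Import Defs.
From mathcomp Require Import all_boot all_order all_algebra.
From mathcomp Require Import boolp.
From mathcomp Require Import ring lra zify.
Set Implicit Arguments. Unset Strict Implicit. Unset Printing Implicit Defensive.
Import GRing.Theory Num.Theory.
Local Open Scope ring_scope.

(* Put G = q^2 f_5^10 / f_1^2 = sum A_5(n) q^(n+2), a modular form of weight 4 on
   Gamma_0(5), and let C = q f_1^4 f_5^4 be the cusp form of that space.  If U
   keeps the even coefficients and V substitutes q^2 for q, then
     U G = 9 G + C - 8 V G,    U C = -4 C - 8 V C,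
   and the theorem is the solution of the linear recursion that these two
   relations induce on the coefficients at 2^k N, N odd.

   The relations are proved without modular forms.  With the Hauptmodul
   t = q f_2 f_10^3 / (f_1^3 f_5) of Gamma_0(10), both 1 + 4t and 1 + 5t are eta
   quotients; this amounts to
     phi(-q^5)^2 - phi(-q)^2 = 4q f_1 f_10^3 / (f_2 f_5),
     psi(q)^2 - q psi(q^5)^2 = f_2 f_5^3 / (f_1 f_10),
   which follow from the Jacobi triple product by splitting Z^2 into the cosets
   of a sublattice of index 5.  Hence G and C are rational functions of t(q) times
   C(q^2), and U becomes a symmetric function of t(q) and t(-q), which are the
   two roots of a quadratic equation with coefficients in Z[t(q^2)]. *)

(** * Formal power series *)

Record ps := PS { coefs :> nat -> int }.

HB.instance Definition _ := gen_eqMixin ps.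
HB.instance Definition _ := gen_choiceMixin ps.

Lemma psP (f g : ps) : (forall n, f n = g n) -> f = g.
Proof. by case: f g => f [g] /= fg; congr PS; apply/funext. Qed.

Definition ps_zero := PS (fun=> 0).
Definition ps_opp (f : ps) := PS (fun n => - f n).
Definition ps_add (f g : ps) := PS (fun n => f n + g n).

Fact ps_addA : associative ps_add.
Proof. by move=> f g h; apply: psP => n /=; rewrite addrA. Qed.
Fact ps_addC : commutative ps_add.
Proof. by move=> f g; apply: psP => n /=; rewrite addrC. Qed.
Fact ps_add0 : left_id ps_zero ps_add.
Proof. by move=> f; apply: psP => n /=; rewrite add0r. Qed.
Fact ps_addN : left_inverse ps_zero ps_opp ps_add.
Proof. by move=> f; apply: psP => n /=; rewrite addNr. Qed.

HB.instance Definition _ :=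
  GRing.isZmodule.Build ps ps_addA ps_addC ps_add0 ps_addN.

Definition ps_one := PS (fun n => (n == 0%N)%:R).
Definition ps_mul (f g : ps) :=
  PS (fun n => \sum_(i < n.+1) f i * g (n - i)%N).

Definition ptrunc n (f : ps) : {poly int} := \poly_(i < n) f i.

(** Coefficients of a product depend only on coefficients of no larger index, so the ring laws of
    [ps] are inherited from [{poly int}] by truncation. *)
Lemma ps_mul_coefM (f g : ps) (p r : {poly int}) n :
  (forall i, (i <= n)%N -> f i = p`_i) ->
  (forall i, (i <= n)%N -> g i = r`_i) ->
  ps_mul f g n = (p * r)`_n.
Proof.
move=> fp gr; rewrite coefM /=; apply: eq_bigr => i _.
by rewrite fp ?gr ?leq_subr // -ltnS.
Qed.

Lemma ptruncE n (f : ps) i : (i <= n)%N -> f i = (ptrunc n.+1 f)`_i.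
Proof. by move=> lin; rewrite coef_poly ltnS lin. Qed.

Fact ps_mulC : commutative ps_mul.
Proof.
move=> f g; apply: psP => n.
rewrite (ps_mul_coefM (@ptruncE n f) (@ptruncE n g)) mulrC.
by rewrite -(ps_mul_coefM (@ptruncE n g) (@ptruncE n f)).
Qed.

Fact ps_mulA : associative ps_mul.
Proof.
move=> f g h; apply: psP => n.
have fgE (f1 f2 : ps) i : (i <= n)%N ->
    ps_mul f1 f2 i = (ptrunc n.+1 f1 * ptrunc n.+1 f2)`_i.
  by move=> lin; apply: ps_mul_coefM => j lji; apply/ptruncE/(leq_trans lji).
rewrite (ps_mul_coefM (@ptruncE n f) (fgE g h)) mulrA.
by rewrite -(ps_mul_coefM (fgE f g) (@ptruncE n h)).
Qed.

Fact ps_mul1 : left_id ps_one ps_mul.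
Proof.
move=> f; apply: psP => n /=.
by rewrite big_ord_recl /= subn0 mul1r big1 ?addr0 // => i _; rewrite mul0r.
Qed.

Fact ps_mulDl : left_distributive ps_mul ps_add.
Proof.
move=> f g h; apply: psP => n /=.
by rewrite -big_split; apply: eq_bigr => i _ /=; rewrite mulrDl.
Qed.

Fact ps_oner_neq0 : ps_one != 0.
Proof. by apply/eqP => /(congr1 (fun f : ps => f 0%N)). Qed.

HB.instance Definition _ := GRing.Zmodule_isComNzRing.Build ps
  ps_mulA ps_mulC ps_mul1 ps_mulDl ps_oner_neq0.

Lemma coefsD (f g : ps) n : (f + g) n = f n + g n. Proof. by []. Qed.
Lemma coefsN (f : ps) n : (- f) n = - f n. Proof. by []. Qed.
Lemma coefsB (f g : ps) n : (f - g) n = f n - g n. Proof. by []. Qed.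
Lemma coefs1 n : (1 : ps) n = (n == 0%N)%:R. Proof. by []. Qed.
Lemma coefsM (f g : ps) n :
  (f * g) n = \sum_(i < n.+1) f i * g (n - i)%N.
Proof. by []. Qed.
Lemma coefsMn (f : ps) k n : (f *+ k) n = f n *+ k.
Proof. by elim: k => [|k IHk]; rewrite ?mulr0n // !mulrS coefsD IHk. Qed.
Lemma coefs_nat k n : (k%:R : ps) n = (n == 0%N)%:R *+ k.
Proof. by rewrite coefsMn. Qed.

Lemma coefsM0 (f g : ps) : (f * g) 0%N = f 0%N * g 0%N.
Proof. by rewrite coefsM big_ord1. Qed.

Lemma coefs_sum I (r : seq I) (P : pred I) (F : I -> ps) n :
  (\sum_(i <- r | P i) F i) n = \sum_(i <- r | P i) F i n.
Proof. by elim/big_rec2: _ => [|i x y _ <-]. Qed.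

Lemma coefsMnat (f : ps) k n : (k%:R * f) n = k%:R * f n.
Proof. by rewrite !mulr_natl coefsMn. Qed.

(* The lowest nonzero coefficients multiply to the lowest one of the product. *)
Fact ps_integral (f g : ps) : f * g = 0 -> (f == 0) || (g == 0).
Proof.
have low (h : ps) : h != 0 ->
    exists2 m, h m != 0 & forall i, (i < m)%N -> h i = 0.
  move=> h0; have exm : exists m, h m != 0.
    apply: contrapT => /forallNP hn; case/eqP: h0; apply: psP => n.
    by apply/eqP/negPn/negP/hn.
  case: (ex_minnP exm) => m hm mmin; exists m => // i lim.
  by apply/eqP/negPn/negP => /mmin; rewrite leqNgt lim.
move=> fg0; apply: contrapT => /negP; rewrite negb_or.
case/andP=> /low[m fm fm0] /low[n gn gn0].
have := congr1 (fun h : ps => h (m + n)%N) fg0.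
have lm : (m < (m + n).+1)%N by rewrite ltnS leq_addr.
rewrite coefsM (bigD1 (Ordinal lm)) //= addKn big1 ?addr0.
  by move/eqP; rewrite mulf_eq0 (negPf fm) (negPf gn).
move=> i; rewrite -val_eqE /= => im.
have [lim|lmi] := ltnP i m; first by rewrite fm0 // mul0r.
rewrite gn0 ?mulr0 //; have := ltn_ord i; lia.
Qed.

(** Inverses are chosen classically; this structure serves to make [ps] an integral domain and so to
    form [{fraction ps}]. *)
Definition ps_unit : {pred ps} := fun f => `[< exists g, g * f = 1 >].
Definition ps_inv (f : ps) : ps :=
  if pselect (exists g, g * f = 1) is left e then sval (cid e) else f.

Fact ps_mulVx : {in ps_unit, left_inverse 1 ps_inv *%R}.
Proof.
move=> f /asboolP fu; rewrite /ps_inv; case: pselect => // e.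
by case: (cid e).
Qed.
Fact ps_unitPl (f g : ps) : g * f = 1 -> ps_unit f.
Proof. by move=> gf; apply/asboolP; exists g. Qed.
Fact ps_invr_out : {in [predC ps_unit], ps_inv =1 id}.
Proof.
move=> f /= fnu; rewrite /ps_inv; case: pselect => // e.
by case/negP: fnu; apply/asboolP.
Qed.

HB.instance Definition _ := GRing.ComNzRing_hasMulInverse.Build ps
  ps_mulVx ps_unitPl ps_invr_out.
HB.instance Definition _ := GRing.ComUnitRing_isIntegral.Build ps ps_integral.

Definition q : ps := PS (fun n => (n == 1%N)%:R).

Lemma coefsqM (f : ps) n : (q * f) n = if n is k.+1 then f k else 0.
Proof.
case: n => [|n]; rewrite coefsM; first by rewrite big_ord1 mul0r.
rewrite big_ord_recl mul0r add0r big_ord_recl /= mul1r subSS subn0 big1 ?addr0 //.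
by move=> i _; rewrite mul0r.
Qed.

Lemma coefsqnM (f : ps) e n :
  (q ^+ e * f) n = if (e <= n)%N then f (n - e)%N else 0.
Proof.
elim: e n => [|e IHe] n; first by rewrite expr0 mul1r subn0.
by rewrite exprS -mulrA coefsqM; case: n => // n; rewrite IHe.
Qed.

Lemma coefsqn e n : (q ^+ e) n = (n == e)%:R.
Proof.
rewrite -[q ^+ e]mulr1 coefsqnM coefs1; case: leqP => [len|lne].
  by rewrite subn_eq0 eqn_leq len andbT.
by rewrite ltn_eqF.
Qed.

Lemma q_neq0 : q != 0.
Proof. by apply/eqP => /(congr1 (fun f : ps => f 1%N)). Qed.

Lemma ps_neq0 (f : ps) : f 0%N != 0 -> f != 0.
Proof. by apply: contra => /eqP ->. Qed.

(* [dil m f] is f(q^m) for m > 0, and the constant term of f for m = 0. *)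
Definition dil m (f : ps) : ps :=
  PS (fun n => if (m %| n)%N then f (n %/ m)%N else 0).

Fact dil_zmod_morphism m : zmod_morphism (dil m).
Proof.
by move=> f g; apply: psP => n /=; case: ifP => // _; rewrite subr0.
Qed.

Fact dil_monoid_morphism m : monoid_morphism (dil m).
Proof.
split=> [|f g]; apply: psP => n.
  rewrite /=; case: m => [|m]; first by rewrite dvd0n; case: n.
  case: (boolP (m.+1 %| n)%N) => [/dvdnP[k ->]|mn].
    by rewrite mulnK // muln_eq0 orbF.
  by case: n mn => //; rewrite dvdn0.
case: m => [|m].
  have E (h : ps) k : dil 0 h k = (k == 0%N)%:R * h 0%N.
    by rewrite /= dvd0n divn0; case: eqP; rewrite ?mul1r ?mul0r.
  rewrite E [RHS]coefsM big_ord_recl big1 ?addr0 => [|i _].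
    by rewrite coefsM0 !E mul1r subn0 mulrCA.
  by rewrite E {1}lift0 /= mul0r mul0r.
have E (h : ps) i : (i <= n)%N -> dil m.+1 h i = (ptrunc n.+1 h \Po 'X^(m.+1))`_i.
  move=> lin; rewrite coef_comp_poly_Xn //=; case: ifP => // _.
  by rewrite -ptruncE // (leq_trans (leq_div _ _)).
rewrite (ps_mul_coefM (E f) (E g)) -comp_polyM coef_comp_poly_Xn //=.
case: ifP => // _; have ln := leq_div n m.+1.
by apply: ps_mul_coefM => i li; apply/ptruncE/(leq_trans li).
Qed.

HB.instance Definition _ m :=
  GRing.isZmodMorphism.Build ps ps (dil m) (dil_zmod_morphism m).
HB.instance Definition _ m :=
  GRing.isMonoidMorphism.Build ps ps (dil m) (dil_monoid_morphism m).

Lemma dilq m : (0 < m)%N -> dil m q = q ^+ m.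
Proof.
move=> m0; apply: psP => n; rewrite coefsqn /=.
case: (boolP (m %| n)%N) => [/dvdnP[k ->]|mn].
  by rewrite mulnK // -{2}[m]mul1n eqn_pmul2r.
by case: eqP mn => // ->; rewrite dvdnn.
Qed.

Lemma dil1 f : dil 1 f = f.
Proof. by apply: psP => n /=; rewrite dvd1n divn1. Qed.

Lemma dil_inj m : (0 < m)%N -> injective (dil m).
Proof.
move=> m0 f g fg; apply: psP => n.
by have := congr1 (fun h : ps => h (n * m)%N) fg; rewrite /= dvdn_mull // mulnK.
Qed.

Lemma dil0 m f : dil m f 0%N = f 0%N.
Proof. by rewrite /= dvdn0 div0n. Qed.

Definition flip (f : ps) : ps := PS (fun n => (-1) ^+ n * f n).

Fact flip_zmod_morphism : zmod_morphism flip.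
Proof. by move=> f g; apply: psP => n; rewrite /= mulrBr. Qed.

Fact flip_monoid_morphism : monoid_morphism flip.
Proof.
split=> [|f g]; apply: psP => n /=.
  by case: n => [|n]; rewrite ?mulr0 ?mulr1.
rewrite mulr_sumr; apply: eq_bigr => i _ /=.
by rewrite mulrACA -exprD subnKC // -ltnS.
Qed.

HB.instance Definition _ :=
  GRing.isZmodMorphism.Build ps ps flip flip_zmod_morphism.
HB.instance Definition _ :=
  GRing.isMonoidMorphism.Build ps ps flip flip_monoid_morphism.

Lemma flipq : flip q = - q.
Proof. by apply: psP => -[|[|n]]; rewrite /= ?coefsN /= ?mulr0 ?oppr0 ?mulr1. Qed.

Lemma flip_dil m f : flip (dil m.*2 f) = dil m.*2 f.
Proof.
apply: psP => n /=; case: ifP => [/dvdnP[k ->]|_]; last by rewrite mulr0.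
by rewrite -signr_odd oddM odd_double andbF mul1r.
Qed.

Definition evens (f : ps) : ps := PS (fun n => f n.*2).

(** VUf is the even part of f, the half sum of f(q) and f(-q); the factor 2 avoids a division in
    [int]. *)
Lemma evens_dil f : 2 * dil 2 (evens f) = f + flip f.
Proof.
apply: psP => n; rewrite coefsMnat coefsD /= divn2 -signr_odd dvdn2.
case: (boolP (odd n)) => on; first by rewrite mulr0 mulN1r subrr.
by rewrite even_halfK // mul1r mulr_natl mulr2n.
Qed.

Lemma coefsE f n : PS f n = f n. Proof. by []. Qed.
Lemma coefs_dil m (f : ps) n :
  dil m f n = if (m %| n)%N then f (n %/ m)%N else 0.
Proof. by []. Qed.
Lemma coefs_flip (f : ps) n : flip f n = (-1) ^+ n * f n. Proof. by []. Qed.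
Lemma coefs_evens (f : ps) n : evens f n = f n.*2. Proof. by []. Qed.

Arguments coefs : simpl never.

(** * Infinite products *)

(** Convergence in the q-adic topology. *)
Definition pslim (F : nat -> ps) (L : ps) :=
  forall n, exists M, forall N, (M <= N)%N -> F N n = L n.

Lemma pslim_upto F L n : pslim F L ->
  exists M, forall N, (M <= N)%N -> forall k, (k <= n)%N -> F N k = L k.
Proof.
move=> FL; elim: n => [|n [M HM]].
  by have [M HM] := FL 0%N; exists M => N MN k; rewrite leqn0 => /eqP ->; apply: HM.
have [M' HM'] := FL n.+1; exists (maxn M M') => N.
rewrite geq_max => /andP[MN M'N] k; rewrite leq_eqVlt => /orP[/eqP -> | kn].
  exact: HM'.
exact: HM.
Qed.

Lemma pslim_unique F L L' : pslim F L -> pslim F L' -> L = L'.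
Proof.
move=> FL FL'; apply: psP => n; have [M HM] := FL n; have [M' HM'] := FL' n.
by rewrite -(HM (maxn M M')) ?leq_maxl // HM' // leq_maxr.
Qed.

Lemma eq_pslim F G L : F =1 G -> pslim F L -> pslim G L.
Proof.
move=> FG FL n; have [M HM] := FL n; exists M => N; rewrite -FG; apply: HM.
Qed.

Lemma pslim_cst L : pslim (fun=> L) L.
Proof. by move=> n; exists 0%N. Qed.

Lemma pslimM F G L K : pslim F L -> pslim G K -> pslim (fun N => F N * G N) (L * K).
Proof.
move=> FL GK n; have [M HM] := pslim_upto n FL; have [M' HM'] := pslim_upto n GK.
exists (maxn M M') => N; rewrite geq_max => /andP[MN M'N].
rewrite !coefsM; apply: eq_bigr => i _.
by rewrite HM ?HM' ?leq_subr // -ltnS.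
Qed.

Lemma pslim_sub (h : nat -> nat) F L : (forall N, N <= h N)%N ->
  pslim F L -> pslim (F \o h) L.
Proof.
move=> hN FL n; have [M HM] := FL n; exists M => N MN /=.
by apply: HM; apply: leq_trans (hN N).
Qed.

Lemma pslim_dil m F L : (0 < m)%N -> pslim F L -> pslim (dil m \o F) (dil m L).
Proof.
move=> m0 FL n; have [M HM] := FL (n %/ m)%N; exists M => N MN /=.
by rewrite !coefs_dil HM.
Qed.

Lemma pslim_flip F L : pslim F L -> pslim (flip \o F) (flip L).
Proof.
by move=> FL n; have [M HM] := FL n; exists M => N MN /=; rewrite !coefs_flip HM.
Qed.

(** If factor [i] is 1 + O(q^i), the factors beyond index [n] leave the coefficient of q^n alone, so
    this diagonal reading is the infinite product. *)
Definition pprod (F : nat -> ps) : ps := PS (fun n => (\prod_(i < n.+1) F i) n).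

Lemma pprod_lim F : (forall i, exists G, F i = 1 + q ^+ i * G) ->
  pslim (fun N => \prod_(i < N) F i) (pprod F).
Proof.
move=> F1 n; exists n.+1; elim=> [//|N IHN].
rewrite leq_eqVlt => /orP[/eqP [<-] //|]; rewrite ltnS => nN.
rewrite big_ord_recr /=; have [G ->] := F1 N.
rewrite mulrDr mulr1 coefsD IHN // mulrCA coefsqnM leqNgt nN.
by rewrite addr0.
Qed.

(** The q-Pochhammer symbol $(-cq^B;q^A)_\infty$. *)
Definition poch (c : int) (A B : nat) : ps :=
  pprod (fun i => 1 + c%:~R * q ^+ (A * i + B)).

Lemma poch_lim c A B : (0 < A)%N ->
  pslim (fun N => \prod_(i < N) (1 + c%:~R * q ^+ (A * i + B))) (poch c A B).
Proof.
move=> A0; apply: pprod_lim => i; exists (c%:~R * q ^+ (A.-1 * i + B)).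
by rewrite mulrCA -exprD addnA -mulSn prednK.
Qed.

Lemma poch0 c A B : (0 < B)%N -> poch c A B 0%N = 1.
Proof.
move=> B0; rewrite /poch /pprod coefsE big_ord_recr big_ord0 /=.
rewrite mul1r muln0 add0n coefsD coefs1.
by rewrite mulrC coefsqnM leqNgt B0 addr0.
Qed.

Lemma dil_poch m c A B : (0 < m)%N -> (0 < A)%N ->
  dil m (poch c A B) = poch c (m * A) (m * B).
Proof.
move=> m0 A0; apply: (pslim_unique (pslim_dil m0 (poch_lim c B A0))).
apply: (eq_pslim _ (poch_lim c (m * B) _)); last by rewrite muln_gt0 m0.
move=> N /=; rewrite rmorph_prod; apply: eq_bigr => i _.
by rewrite rmorphD rmorph1 rmorphM rmorph_int rmorphXn /= dilq // -exprM -mulnA mulnDr.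
Qed.

Lemma flip_poch_odd c A B : (0 < A)%N -> ~~ odd A -> odd B ->
  flip (poch c A B) = poch (- c) A B.
Proof.
move=> A0 eA oB; apply: (pslim_unique (pslim_flip (poch_lim c B A0))).
apply: (eq_pslim _ (poch_lim (- c) B A0)) => N /=.
rewrite rmorph_prod; apply: eq_bigr => i _.
rewrite rmorphD rmorph1 rmorphM rmorph_int rmorphXn /= flipq exprNn.
by rewrite -signr_odd oddD oddM (negPf eA) oB mulN1r mulrN mulrNz mulNr.
Qed.

Lemma poch_conj A B : (0 < A)%N ->
  poch 1 A B * poch (-1) A B = poch (-1) (2 * A) (2 * B).
Proof.
move=> A0; apply: (pslim_unique (pslimM (poch_lim 1 B A0) (poch_lim (-1) B A0))).
apply: (eq_pslim _ (poch_lim (-1) (2 * B) _)); last by rewrite muln_gt0.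
move=> N; rewrite -big_split; apply: eq_bigr => i _ /=.
by rewrite -mulnA -mulnDr [(2 * _)%N]mulnC exprM; ring.
Qed.

Lemma poch_shift c A B : (0 < A)%N ->
  poch c A B = (1 + c%:~R * q ^+ B) * poch c A (A + B).
Proof.
move=> A0; apply: (pslim_unique (pslim_sub _ (poch_lim c B A0))).
  exact: leqnSn.
apply: eq_pslim (pslimM (pslim_cst _) (poch_lim c (A + B) A0)) => N /=.
rewrite big_ord_recl /= muln0 add0n; congr (_ * _); apply: eq_bigr => i _.
by rewrite /bump leq0n; congr (1 + _ * q ^+ _); lia.
Qed.

(** The factors are sorted by the residue of their index modulo [m]; partial products of [N * m]
    factors regroup exactly. *)
Lemma poch_split m c A B : (0 < m)%N -> (0 < A)%N ->
  poch c A B = \prod_(r < m) poch c (A * m) (A * r + B).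
Proof.
move=> m0 A0; have hN N : (N <= N * m)%N by rewrite leq_pmulr.
apply: (pslim_unique (pslim_sub hN (poch_lim c B A0))).
have Am0 : (0 < A * m)%N by rewrite muln_gt0 A0.
have prod_lim k : pslim
    (fun N => \prod_(r < k) \prod_(i < N) (1 + c%:~R * q ^+ (A * m * i + (A * r + B))))
    (\prod_(r < k) poch c (A * m) (A * r + B)).
  elim: k => [|k IHk].
    by rewrite big_ord0; apply: eq_pslim (pslim_cst 1) => N; rewrite big_ord0.
  rewrite big_ord_recr; apply: eq_pslim (pslimM IHk (poch_lim _ _ Am0)) => N.
  by rewrite [RHS]big_ord_recr.
apply: (eq_pslim _ (prod_lim m)) => N /=.
rewrite exchange_big /=; elim: N => [|N IHN]; first by rewrite mul0n !big_ord0.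
rewrite big_ord_recr IHN mulSn addnC big_split_ord; congr (_ * _).
apply: eq_bigr => r _ /=; congr (1 + _ * q ^+ _); lia.
Qed.

(** * Generating functions of fibres *)

Lemma sum_nat_count (T : Type) (s : seq T) (P : pred T) :
  \sum_(i <- s) (P i)%:R = (count P s)%:Z.
Proof.
by elim: s => [|i s IHs]; rewrite ?big_nil // big_cons IHs /= PoszD; case: (P i).
Qed.

(* [gen w] is the generating function of the sizes of the fibres of w; a fibre
   is counted through an arbitrary duplicate-free list containing it. *)
Definition gen (I : eqType) (w : I -> nat) : ps := PS (fun n =>
  if pselect (exists s : seq I, uniq s /\ forall i, w i = n -> i \in s) is left e
  then (count (fun i => w i == n) (sval (cid e)))%:Z else 0).

Definition finfib (I : eqType) (w : I -> nat) :=
  forall n, exists s : seq I, uniq s /\ forall i, (w i <= n)%N -> i \in s.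

Lemma genE (I : eqType) (w : I -> nat) n (s : seq I) :
  uniq s -> (forall i, w i = n -> i \in s) ->
  gen w n = \sum_(i <- s) (w i == n)%:R.
Proof.
move=> us ws; rewrite /gen coefsE; case: pselect => [e|[]]; last by exists s.
case: (cid e) => s' [us' ws'] /=; rewrite sum_nat_count -!size_filter.
congr Posz; apply/perm_size/uniq_perm; rewrite ?filter_uniq // => i.
rewrite !mem_filter; case: eqP => //= wi.
by rewrite ws ?ws'.
Qed.

Lemma gen_bij (I J : eqType) (h : J -> I) (w : I -> nat) (w' : J -> nat) :
  bijective h -> finfib w -> w' =1 w \o h -> gen w' = gen w.
Proof.
move=> [g hK gK] fw w'E; apply: psP => n; have [s [us ws]] := fw n.
have ws' i : w i = n -> i \in s by move=> wi; apply: ws; rewrite wi.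
rewrite (genE us ws') (@genE _ _ _ (map g s)).
- by rewrite big_map; apply: eq_bigr => i _; rewrite w'E /= gK.
- by rewrite map_inj_uniq //; apply: can_inj gK.
- by move=> j wj; rewrite -(hK j) map_f // ws' // -wj w'E.
Qed.

Lemma finfibD (I J : eqType) (w : I -> nat) (w' : J -> nat) :
  finfib w -> finfib w' -> finfib (fun x : I * J => w x.1 + w' x.2)%N.
Proof.
move=> fw fw' n; have [s [us ws]] := fw n; have [s' [us' ws']] := fw' n.
exists [seq (i, j) | i <- s, j <- s']; split.
  by apply: allpairs_uniq => // -[i j] [i' j'].
move=> [i j] /= wij; apply: allpairs_f; [apply: ws|apply: ws']; lia.
Qed.

Lemma genM (I J : eqType) (w : I -> nat) (w' : J -> nat) :
  finfib w -> finfib w' ->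
  gen (fun x : I * J => w x.1 + w' x.2)%N = gen w * gen w'.
Proof.
move=> fw fw'; apply: psP => n.
have [s [us ws]] := fw n; have [s' [us' ws']] := fw' n.
rewrite (@genE _ _ _ [seq (i, j) | i <- s, j <- s']); last 2 first.
- by apply: allpairs_uniq => // -[i j] [i' j'].
- by move=> [i j] /= wij; apply: allpairs_f; [apply: ws|apply: ws']; lia.
rewrite coefsM big_allpairs.
under [RHS]eq_bigr => k _.
  rewrite (genE us) => [|i wi]; last by apply: ws; rewrite wi -ltnS.
  rewrite (genE us') => [|j wj]; last by apply: ws'; rewrite wj leq_subr.
  rewrite mulr_suml; under eq_bigr do rewrite mulr_sumr.
  over.
rewrite [RHS]exchange_big; apply: eq_bigr => i _ /=; rewrite [RHS]exchange_big.
apply: eq_bigr => j _ /=.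
have [win|nwi] := leqP (w i) n.
  rewrite (bigD1 (Ordinal (win : (w i < n.+1)%N))) //= eqxx mul1r big1 ?addr0.
    by congr (_ %:R); congr nat_of_bool; lia.
  by move=> k; rewrite -val_eqE /= eq_sym => /negPf ->; rewrite mul0r.
rewrite big1 => [|k _]; last first.
  by rewrite gtn_eqF ?mul0r // (leq_ltn_trans _ nwi) // -ltnS.
by rewrite gtn_eqF // (leq_trans nwi) // leq_addr.
Qed.

Lemma genDl (I : eqType) (w : I -> nat) e : finfib w ->
  gen (fun i => e + w i)%N = q ^+ e * gen w.
Proof.
move=> fw; apply: psP => n; rewrite coefsqnM; have [s [us ws]] := fw n.
rewrite (genE us); last by move=> i wi; apply: ws; lia.
have [len|lne] := leqP e n; last by rewrite big1 // => i _; rewrite gtn_eqF //; lia.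
rewrite (genE us); last by move=> i wi; apply: ws; lia.
by apply: eq_bigr => i _; congr (_ %:R); congr nat_of_bool; lia.
Qed.

Lemma gen_split (I : eqType) m (w : I * 'I_m -> nat) : finfib w ->
  gen w = \sum_(r < m) gen (fun i => w (i, r)).
Proof.
move=> fw; apply: psP => n; have [s [_ ws]] := fw n; rewrite coefs_sum.
pose s0 := undup (map fst s).
have s0P i r : w (i, r) = n -> i \in s0.
  by move=> wi; rewrite mem_undup -[i]/((i, r).1) map_f // ws // wi.
rewrite (@genE _ _ _ [seq (i, r) | i <- s0, r <- enum 'I_m]); last 2 first.
- by apply: allpairs_uniq; rewrite ?undup_uniq ?enum_uniq // => -[i j] [i' j'].
- by move=> [i r] wi; apply: allpairs_f; [apply: s0P wi|rewrite mem_enum].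
under [RHS]eq_bigr do rewrite (genE (undup_uniq _) (s0P ^~ _)).
rewrite big_allpairs [RHS]exchange_big /=; apply: eq_bigr => i _.
by rewrite big_enum.
Qed.

(* The exponent A n(n-1)/2 + B n for n in Z, division-free; needs B <= A because
   of the truncated subtraction. *)
Definition tw (A B : nat) (n : int) : nat :=
  match n with
  | Posz n => A * 'C(n, 2) + B * n
  | Negz m => A * 'C(m.+1, 2) + (A - B) * m.+1
  end.

Lemma mul2bin2 n : (2 * 'C(n, 2) + n = n * n)%N.
Proof. by elim: n => // n IHn; rewrite binS bin1; lia. Qed.

(** Doubled and cast to [int], both branches of [tw] become one polynomial; later comparisons of
    exponents go through this form. *)
Lemma tw2 A B n : (B <= A)%N ->
  2 * (tw A B n)%:Z = A%:Z * n * (n - 1) + 2 * B%:Z * n.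
Proof.
move=> BA; case: n => n /=.
  have := mul2bin2 n; nia.
have := mul2bin2 n.+1; rewrite NegzE.
have [D ->] : exists D, A = (B + D)%N by exists (A - B)%N; lia.
rewrite addKn; nia.
Qed.

(** Linear growth suffices for finite fibres. The successor cannot be dropped: [tw A 0 1] is 0. *)
Lemma tw_ge A B n : (0 < A)%N -> (`|n|%N <= (tw A B n).+1)%N.
Proof.
move=> A0; case: n => n /=; rewrite ?absz_nat ?abszN.
  by have := mul2bin2 n; nia.
have := mul2bin2 n.+1; rewrite /absz; nia.
Qed.

Definition irange N : seq int := [seq k%:Z - N%:Z | k <- iota 0 (2 * N).+1].

Lemma irange_uniq N : uniq (irange N).
Proof. by rewrite map_inj_uniq ?iota_uniq // => i j; lia. Qed.

Lemma mem_irange N (n : int) : (`|n|%N <= N)%N -> n \in irange N.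
Proof.
move=> nN; apply/mapP; exists `|(n + N%:Z)%R|%N; last by lia.
by rewrite mem_iota; lia.
Qed.

Lemma finfib_tw A B : (0 < A)%N -> finfib (tw A B).
Proof.
move=> A0 n; exists (irange n.+1); split; first exact: irange_uniq.
move=> i tin; apply: mem_irange.
by apply: leq_trans (tw_ge B i A0) _; rewrite ltnS.
Qed.

Lemma gen_tw_lim A B : (0 < A)%N ->
  pslim (fun N => \sum_(k < (2 * N).+1) q ^+ tw A B (k%:Z - N%:Z)) (gen (tw A B)).
Proof.
move=> A0 n; exists n.+1 => N nN.
rewrite coefs_sum (genE (irange_uniq N)); last first.
  move=> i ti; apply: mem_irange; apply: leq_trans nN.
  by rewrite -ti; apply: tw_ge.
rewrite big_map -[iota _ _]/(index_iota 0 (2 * N).+1) big_mkord.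
by apply: eq_bigr => k _; rewrite coefsqn eq_sym.
Qed.

(** * The Jacobi triple product *)

(** Gaussian binomials through a Pascal rule, so that [R] needs no division. *)
Fixpoint qbinom (R : comNzRingType) (p : R) n k : R :=
  match n, k with
  | _, 0 => 1
  | 0, _.+1 => 0
  | n'.+1, k'.+1 => qbinom p n' k + p ^+ (n' - k') * qbinom p n' k'
  end.

Lemma qbinom_small (R : comNzRingType) (p : R) n k : (n < k)%N -> qbinom p n k = 0.
Proof.
elim: n k => [|n IHn] [|k] //= nk.
by rewrite !IHn ?mulr0 ?addr0 // ltnW.
Qed.

Lemma qbinom0 (R : comNzRingType) (p : R) n : qbinom p n 0 = 1.
Proof. by case: n. Qed.

(** The q-binomial theorem, homogeneous in [a] and [b] so that it can be recentred without negative
    powers. *)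
Lemma prod_qbinom (R : comNzRingType) (p a b : R) n :
  \prod_(i < n) (a + b * p ^+ i) =
    \sum_(k < n.+1) qbinom p n k * p ^+ 'C(k, 2) * a ^+ (n - k) * b ^+ k.
Proof.
elim: n => [|n IHn].
  by rewrite big_ord0 big_ord_recr big_ord0 /= !expr0; ring.
rewrite big_ord_recr IHn /= mulrDr [RHS]big_ord_recl /=.
under [X in _ = _ + X]eq_bigr => k _.
  rewrite /bump leq0n add1n /= mulrDl mulrDl mulrDl subSS.
  over.
rewrite big_split /= addrA; congr (_ + _).
  rewrite mulr_suml big_ord_recl [X in _ = _ + X]big_ord_recr /=.
  rewrite (qbinom_small p (ltnSn n)) !mul0r addr0 !qbinom0; congr (_ + _).
    by rewrite !subn0 exprSr; ring.
  apply: eq_bigr => i _; rewrite /bump leq0n add1n.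
  have -> : (n - i)%N = (n - i.+1).+1 by have := ltn_ord i; lia.
  by rewrite [a ^+ _.+1]exprSr mulrA mulrAC.
rewrite mulr_suml; apply: eq_bigr => i _; rewrite add0n binS bin1.
have -> : p ^+ n = p ^+ (n - i) * p ^+ i by rewrite -exprD subnK // -ltnS.
rewrite exprD [b ^+ _.+1]exprS; by ring.
Qed.

Lemma qbinom_fact (R : comNzRingType) (p : R) n k : (k <= n)%N ->
  qbinom p n k * \prod_(i < k) (1 - p ^+ i.+1) * \prod_(i < n - k) (1 - p ^+ i.+1)
    = \prod_(i < n) (1 - p ^+ i.+1).
Proof.
elim: n k => [|n IHn] [|k] // kn; first by rewrite /= !big_ord0 !mulr1.
  by rewrite qbinom0 big_ord0 !mul1r subn0.
rewrite ltnS in kn; rewrite /= subSS mulrDl mulrDl.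
rewrite [RHS]big_ord_recr /= -(IHn k kn).
(* The ratio of neighbouring Gaussian binomials, cross-multiplied. What remains is 1 - p^(n-k) +
   p^(n-k) (1 - p^(k+1)) = 1 - p^(n+1). *)
have -> : qbinom p n k.+1 * \prod_(i < k.+1) (1 - p ^+ i.+1)
      * \prod_(i < n - k) (1 - p ^+ i.+1)
    = (1 - p ^+ (n - k)) * (qbinom p n k * \prod_(i < k) (1 - p ^+ i.+1)
      * \prod_(i < n - k) (1 - p ^+ i.+1)).
  have [nk|kn'] := leqP n k.
    have -> : (n - k)%N = 0%N by lia.
    by rewrite qbinom_small // subrr !mul0r.
  rewrite (IHn k kn) -(IHn k.+1 kn').
  have -> : (n - k)%N = (n - k.+1).+1 by lia.
  by rewrite [X in _ * X = _]big_ord_recr /=; ring.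
have -> : n.+1 = ((n - k) + k.+1)%N by lia.
by rewrite big_ord_recr /= exprD; ring.
Qed.

Lemma eqmM n (f f' g g' : ps) :
  (forall k, (k <= n)%N -> f k = f' k) -> (forall k, (k <= n)%N -> g k = g' k) ->
  forall k, (k <= n)%N -> (f * g) k = (f' * g') k.
Proof.
move=> ff' gg' k kn; rewrite !coefsM; apply: eq_bigr => i _.
by rewrite ff' ?gg' //; have := ltn_ord i; lia.
Qed.

(** Coefficient k of [f * g] is [g k] plus terms in earlier coefficients of [g], so strong induction
    cancels [f] modulo q^(n+1). *)
Lemma eqm_cancel n (f g h : ps) : f 0%N = 1 ->
  (forall k, (k <= n)%N -> (f * g) k = (f * h) k) ->
  forall k, (k <= n)%N -> g k = h k.
Proof.
move=> f1 fgh k; elim/ltn_ind: k => k IHk kn.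
have := fgh k kn; rewrite !coefsM !big_ord_recl f1 !mul1r /= subn0.
have -> : \sum_(i < k) f (bump 0 i) * g (k - bump 0 i)%N
        = \sum_(i < k) f (bump 0 i) * h (k - bump 0 i)%N.
  apply: eq_bigr => i _; rewrite IHk // /bump leq0n; have := ltn_ord i; lia.
by move/addIr.
Qed.

(** The finite form of the triple product: the q-binomial theorem with 2N factors, its summation
    index recentred at N. *)
Lemma jacobi_fin A B N : (0 < A)%N -> (B <= A)%N ->
  \prod_(i < N) (1 + q ^+ (A * i + B)) * \prod_(i < N) (1 + q ^+ (A * i + (A - B)))
    = \sum_(k < (2 * N).+1) qbinom (q ^+ A) (2 * N) k * q ^+ tw A B (k%:Z - N%:Z).
Proof.
(* [E] collects the powers pulled out of the factors: A N^2 from those with i >= N, and A N(N-1)/2 +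
   B N from those with i < N, whose order is then reversed. *)
move=> A0 BA; pose E := (A * ('C(N, 2) + N * N) + B * N)%N.
apply: (@mulfI _ (q ^+ E)); first by rewrite expf_neq0 // q_neq0.
transitivity (\prod_(i < 2 * N) (q ^+ (A * N) + q ^+ B * (q ^+ A) ^+ i)).
  rewrite mul2n -addnn big_split_ord /=.
  have -> : \prod_(i < N) (q ^+ (A * N) + q ^+ B * (q ^+ A) ^+ (N + i))
      = q ^+ (A * (N * N)) * \prod_(i < N) (1 + q ^+ (A * i + B)).
    have -> : q ^+ (A * (N * N)) = \prod_(i < N) q ^+ (A * N).
      by rewrite prodr_const card_ord -exprM mulnA.
    rewrite -big_split.
    apply: eq_bigr => i _ /=; rewrite -exprM mulrDr mulr1 -!exprD.
    by congr (_ + q ^+ _); lia.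
  have -> : \prod_(i < N) (q ^+ (A * N) + q ^+ B * (q ^+ A) ^+ i)
      = q ^+ (A * 'C(N, 2) + B * N) * \prod_(i < N) (1 + q ^+ (A * i + (A - B))).
    rewrite [X in _ = _ * X](reindex_inj rev_ord_inj) /=.
    have -> : q ^+ (A * 'C(N, 2) + B * N) = \prod_(i < N) q ^+ (A * i + B).
      rewrite -expr_sum big_split /= -big_distrr /= sum_nat_const card_ord.
      by rewrite -triangular_sum big_mkord [(N * B)%N]mulnC.
    rewrite -big_split; apply: eq_bigr => i _ /=.
    rewrite -exprM mulrDr mulr1 -!exprD addrC [(B + _)%N]addnC.
    congr (_ + q ^+ _); have := ltn_ord i => iN.
    have := leq_mul (leqnn A) iN; rewrite mulnBr mulnS; lia.
  by rewrite /E mulnDr !exprD; ring.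
rewrite prod_qbinom mulr_sumr; apply: eq_bigr => k _.
rewrite -!exprM mulrCA -!mulrA -!exprD; congr (_ * q ^+ _).
have kN : (k <= 2 * N)%N by rewrite -ltnS.
have := tw2 (k%:Z - N%:Z) BA; move: (tw _ _ _) => t.
have := mul2bin2 k; have := mul2bin2 N; rewrite /E.
move: 'C(k, 2) 'C(N, 2) kN => c d; move: (nat_of_ord k) => {}k.
move=> kN h1 h2 h3.
apply/eqP; rewrite -(eqn_pmul2l (isT : (0 < 2)%N)); apply/eqP.
suff : (2 * (A * (d + N * N) + B * N + t))%:Z
     = (2 * (A * c + (A * N * (2 * N - k) + B * k)))%:Z by case.
have h1' : d%:Z * 2 = N%:Z * N%:Z - N%:Z by lia.
have h2' : c%:Z * 2 = k%:Z * k%:Z - k%:Z by lia.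
rewrite !PoszM !PoszD !PoszM -subzn // !PoszD !PoszM.
have -> : 2%:Z * (A%:Z * (d%:Z + N%:Z * N%:Z) + B%:Z * N%:Z + t%:Z) =
  A%:Z * (d%:Z * 2 + 2 * N%:Z * N%:Z) + 2 * B%:Z * N%:Z + 2 * t%:Z by ring.
have -> : 2%:Z * (A%:Z * c%:Z + (A%:Z * N%:Z * (2%:Z * N%:Z - k%:Z) + B%:Z * k%:Z)) =
  A%:Z * (c%:Z * 2) + 2 * (A%:Z * N%:Z * (2%:Z * N%:Z - k%:Z) + B%:Z * k%:Z) by ring.
by rewrite h1' h2' h3; ring.
Qed.

(** The limit of [jacobi_fin]: for the coefficient of q^n only indices k within n + 1 of N matter,
    and there the Gaussian binomial tends to 1/P. *)
Lemma jacobi_triple A B : (0 < A)%N -> (B <= A)%N ->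
  gen (tw A B) = poch (-1) A A * (poch 1 A B * poch 1 A (A - B)).
Proof.
move=> A0 BA; set P := poch (-1) A A.
have Plim : pslim (fun N => \prod_(i < N) (1 - (q ^+ A) ^+ i.+1)) P.
  apply: eq_pslim (poch_lim (-1) A A0) => N; apply: eq_bigr => i _.
  by rewrite -exprM mulnS addnC mulrN1z mulN1r.
have P0 : P 0%N = 1 by apply: poch0.
apply: (pslim_unique (gen_tw_lim B A0)).
have := pslimM (pslim_cst P) (pslimM (poch_lim 1 B A0) (poch_lim 1 (A - B) A0)).
move=> PQ n; have [M HM] := PQ n; have [M' HM'] := pslim_upto n Plim.
(* With this bound both k and 2N - k are at least [M'] as soon as k is within n + 1 of N. *)
exists (maxn M (M' + n.+1)) => N; rewrite geq_max => /andP[MN M'N].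
rewrite -(HM N) // {PQ HM MN}.
have -> : \prod_(i < N) (1 + 1%:~R * q ^+ (A * i + B))
    * \prod_(i < N) (1 + 1%:~R * q ^+ (A * i + (A - B)))
    = \prod_(i < N) (1 + q ^+ (A * i + B))
    * \prod_(i < N) (1 + q ^+ (A * i + (A - B))).
  by congr (_ * _); apply: eq_bigr => i _; rewrite mul1r.
rewrite jacobi_fin // mulr_sumr !coefs_sum; apply: eq_bigr => k _.
rewrite mulrA mulrC coefsqnM coefsqn.
have kN : (k <= 2 * N)%N by rewrite -ltnS.
have [tn|nt] := leqP (tw A B (k%:Z - N%:Z)) n; last by rewrite ltn_eqF.
have := leq_trans (tw_ge B (k%:Z - N%:Z) A0) (tn : _ < n.+1)%N => kNn.
have -> : (n == tw A B (k%:Z - N%:Z))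
    = (n - tw A B (k%:Z - N%:Z) == 0)%N by rewrite subn_eq0 eqn_leq tn andbT.
rewrite -coefs1; move: (leq_subr (tw A B (k%:Z - N%:Z)) n).
move: (n - _)%N => j jn; apply/esym; move: j jn.
(* After one more multiplication by [P] the claim becomes [qbinom_fact], whose three products all
   agree with [P] up to degree [n]. *)
apply: (eqm_cancel P0) => j jn; apply/esym.
rewrite mulr1 -(HM' (2 * N)%N) // -?(qbinom_fact _ kN); last by lia.
have PM f m : (M' <= m)%N -> forall i, (i <= n)%N ->
    (f * \prod_(i < m) (1 - (q ^+ A) ^+ i.+1)) i = (f * P) i.
  by move=> mM; apply: eqmM => // i; apply: HM'.
rewrite [LHS]PM //; last by lia.
rewrite [_ * P]mulrC; apply: eqmM jn => // i ni.
by rewrite PM // ?[P * _]mulrC //; lia.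
Qed.

(** * Theta identities of level 10 *)

Lemma finfib_bij (I J : eqType) (h : J -> I) (w : I -> nat) :
  bijective h -> finfib w -> finfib (w \o h).
Proof.
move=> [g hK gK] fw n; have [s [us ws]] := fw n; exists (map g s); split.
  by rewrite map_inj_uniq //; apply: can_inj gK.
by move=> j wj; rewrite -(hK j) map_f // ws.
Qed.

(* The index-5 sublattices {b = 2a mod 5} of Z^2 and their cosets; the forms
   a^2 + b^2 and a(a+1)/2 + b(b+1)/2 separate in the coordinates m, n. *)
Lemma gen_cosets5 (w : int * int -> nat) : finfib w ->
  gen w = \sum_(r < 5) gen (fun x => w (x.1 - 2 * x.2, 2 * x.1 + x.2 + r%:Z)).
Proof.
move=> fw.
pose h (y : int * int * 'I_5) : int * int :=
  (y.1.1 - 2 * y.1.2, 2 * y.1.1 + y.1.2 + y.2%:Z).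
(* The inverse of [h]: Euclidean division b - 2a = 5n + r yields n and r, then m = a + 2n. *)
pose g (x : int * int) : int * int * 'I_5 :=
  ((x.1 + 2 * (((x.2 - 2 * x.1)%R %/ 5)%Z), ((x.2 - 2 * x.1)%R %/ 5)%Z),
   inord `|((x.2 - 2 * x.1)%R %% 5)%Z|).
have hbij : bijective h.
  exists g; rewrite /h /g.
    move=> [[m n] r] /=.
    have -> : 2 * m + n + r%:Z - 2 * (m - 2 * n) = n * 5 + r%:Z by ring.
    have r5 : 0 <= r%:Z < 5 by have := ltn_ord r; lia.
    rewrite divzMDl // modzMDl divz_small // modz_small //.
    by rewrite addr0 /= inord_val; congr (_, _, _); ring.
  move=> [a b] /=.
  have := divz_eq (b - 2 * a) 5; have := ltz_mod (b - 2 * a) (isT : 5 != 0 :> int).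
  have := modz_ge0 (b - 2 * a) (isT : 5 != 0 :> int).
  move: (_ %/ _)%Z (_ %% _)%Z => d [r|//] _ r5 E.
  by rewrite absz_nat inordK //; congr (_, _); lia.
rewrite -(@gen_bij _ _ h w (w \o h) hbij fw) //.
exact: gen_split (finfib_bij hbij fw).
Qed.

Lemma affine_bij (s c : int) : s * s = 1 -> bijective (fun n : int => s * n + c).
Proof.
move=> ss; exists (fun n => s * (n - c)) => n; first by rewrite addrK mulrA ss mul1r.
by rewrite mulrA ss mul1r subrK.
Qed.

Lemma gen_tw_affine (w : int * int -> nat) e A B A' B' (s c s' c' : int) :
  s * s = 1 -> s' * s' = 1 -> (0 < A)%N -> (0 < A')%N ->
  (forall m n : int, w (m, n) = e + (tw A B (s * m + c) + tw A' B' (s' * n + c')))%N ->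
  gen w = q ^+ e * (gen (tw A B) * gen (tw A' B')).
Proof.
move=> ss ss' A0 A0' wE.
have fA := finfib_tw B A0; have fA' := finfib_tw B' A0'.
rewrite -genM // -genDl; last exact: finfibD.
apply: (@gen_bij _ _ (fun x => (s * x.1 + c, s' * x.2 + c'))).
- have [g gK Kg] := affine_bij c ss; have [g' gK' Kg'] := affine_bij c' ss'.
  exists (fun x => (g x.1, g' x.2)) => -[m n] /=; first by rewrite gK gK'.
  by rewrite Kg Kg'.
- move=> n; have [s0 [us0 ws0]] := finfibD fA fA' n; exists s0; split=> // i wi.
  by apply: ws0; apply: leq_trans wi; apply: leq_addl.
- by move=> [m n] /=; rewrite wE.
Qed.

Definition tw_poly (A B : nat) (n : int) : int := A%:Z * n * (n - 1) + 2 * B%:Z * n.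

Lemma gen_coset_term A0 B0 r e A B A' B' (s c s' c' : int) :
  s * s = 1 -> s' * s' = 1 -> (0 < A)%N -> (0 < A')%N ->
  (B0 <= A0)%N -> (B <= A)%N -> (B' <= A')%N ->
  (forall m n : int,
    tw_poly A0 B0 (m - 2 * n) + tw_poly A0 B0 (2 * m + n + r) =
      2 * e%:Z + (tw_poly A B (s * m + c) + tw_poly A' B' (s' * n + c'))) ->
  gen (fun x : int * int =>
      tw A0 B0 (x.1 - 2 * x.2)%R + tw A0 B0 (2 * x.1 + x.2 + r)%R)%N
    = q ^+ e * (gen (tw A B) * gen (tw A' B')).
Proof.
move=> ss ss' A0gt A0'gt BA0 BA BA' eqp.
apply: (gen_tw_affine (c := c) (c' := c') ss ss') => // m n /=.
have := eqp m n; rewrite /tw_poly -!tw2 //.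
move: (tw _ _ _) (tw _ _ _) (tw _ _ _) (tw _ _ _) => a b c1 d; lia.
Qed.

(** Here [tw 2 1 n] is n^2, so the left side is phi(q)^2. The coset r = 0 gives phi(q^5)^2; each
    other coset contains one unit vector, whence the factor q, and the four contributions agree. *)
Lemma theta21_sq :
  gen (tw 2 1) ^+ 2 =
    gen (tw 10 5) ^+ 2 + 4 * q * (gen (tw 10 9) * gen (tw 10 7)).
Proof.
have f := finfib_tw 1 (isT : (0 < 2)%N).
rewrite expr2 -genM // gen_cosets5; last exact: finfibD.
rewrite !big_ord_recr big_ord0 /= add0r.
rewrite (@gen_coset_term _ _ _ 0 10 5 10 5 1 0 1 0) //;
  last by move=> m n; rewrite /tw_poly; ring.
rewrite (@gen_coset_term _ _ _ 1 10 9 10 7 1 0 1 0) //;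
  last by move=> m n; rewrite /tw_poly; ring.
rewrite (@gen_coset_term _ _ _ 1 10 7 10 9 (-1) (-1) 1 0) //;
  last by move=> m n; rewrite /tw_poly; ring.
rewrite (@gen_coset_term _ _ _ 1 10 7 10 9 1 1 (-1) (-1)) //;
  last by move=> m n; rewrite /tw_poly; ring.
rewrite (@gen_coset_term _ _ _ 1 10 9 10 7 (-1) (-2) (-1) (-1)) //;
  last by move=> m n; rewrite /tw_poly; ring.
ring.
Qed.

(** Over Z each triangular number occurs twice, so [gen (tw 1 1)] is 2 psi(q). The coset r = 3,
    stable under (a, b) -> (-1-a, -1-b), gives q (2 psi(q^5))^2; the four others agree. *)
Lemma theta11_sq :
  gen (tw 1 1) ^+ 2 =
    4 * (gen (tw 5 4) * gen (tw 5 2)) + q * gen (tw 5 5) ^+ 2.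
Proof.
have f := finfib_tw 1 (isT : (0 < 1)%N).
rewrite expr2 -genM // gen_cosets5; last exact: finfibD.
rewrite !big_ord_recr big_ord0 /= add0r.
rewrite (@gen_coset_term _ _ _ 0 5 4 5 2 1 0 1 0) //;
  last by move=> m n; rewrite /tw_poly; ring.
rewrite (@gen_coset_term _ _ _ 0 5 4 5 2 (-1) (-1) (-1) 0) //;
  last by move=> m n; rewrite /tw_poly; ring.
rewrite (@gen_coset_term _ _ _ 0 5 2 5 4 (-1) (-1) 1 0) //;
  last by move=> m n; rewrite /tw_poly; ring.
rewrite (@gen_coset_term _ _ _ 1 5 5 5 5 1 1 1 0) //;
  last by move=> m n; rewrite /tw_poly; ring.
rewrite (@gen_coset_term _ _ _ 0 5 2 5 4 1 2 (-1) (-1)) //;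
  last by move=> m n; rewrite /tw_poly; ring.
ring.
Qed.

(** The product f_m. *)
Definition euler m : ps := poch (-1) m m.

Lemma dil_euler m n : (0 < m)%N -> (0 < n)%N -> dil m (euler n) = euler (m * n).
Proof. by move=> m0 n0; apply: dil_poch. Qed.

Lemma euler0 m : (0 < m)%N -> euler m 0%N = 1.
Proof. exact: poch0. Qed.

Lemma flip_euler m : (0 < m)%N -> flip (euler m.*2) = euler m.*2.
Proof. by move=> m0; rewrite -[m.*2]muln1 -dil_euler ?double_gt0 // flip_dil. Qed.

(** [theta21_sq] at -q, with phi(-q) = f_1^2 / f_2, cleared of denominators. Both sides are compared
    after splitting the products by odd residues modulo 10. *)
Lemma euler_phi_identity :
  euler 5 ^+ 5 * euler 2 ^+ 2 =
    euler 1 ^+ 4 * euler 10 ^+ 2 * euler 5 + 4 * q * euler 1 * euler 2 * euler 10 ^+ 5.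
Proof.
have := congr1 flip theta21_sq.
rewrite !jacobi_triple // !(rmorphD, rmorphM, rmorphXn, rmorph_nat) /=.
rewrite flipq -!/(euler _).
rewrite (flip_euler (isT : 0 < 1)%N) (flip_euler (isT : 0 < 5)%N) !flip_poch_odd //.
have -> : euler 1 = poch (-1) 2 1 * euler 2.
  by rewrite /euler (@poch_split 2) // !big_ord_recr big_ord0 /= mul1r.
have -> : poch (-1) 2 1 = poch (-1) 10 1 * poch (-1) 10 3 * poch (-1) 10 5
    * poch (-1) 10 7 * poch (-1) 10 9.
  by rewrite (@poch_split 5) // !big_ord_recr big_ord0 /= mul1r.
have -> : euler 5 = poch (-1) 10 5 * euler 10.
  by rewrite /euler (@poch_split 2) // !big_ord_recr big_ord0 /= mul1r.
set p1 := poch _ 10 1; set p3 := poch _ 10 3; set p5 := poch _ 10 5.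
set p7 := poch _ 10 7; set p9 := poch _ 10 9.
rewrite -[1.*2]/2%N -[5.*2]/10%N => H.
set e2 := euler 2 in H *; set e10 := euler 10 in H *.
transitivity (e10 ^+ 3 * p5 * e2 ^+ 2 * (e10 * (p5 * p5)) ^+ 2); first by ring.
have -> : (e10 * (p5 * p5)) ^+ 2
    = (e2 * (p1 * p3 * p5 * p7 * p9 * (p1 * p3 * p5 * p7 * p9))) ^+ 2
      + 4 * q * (e10 * (p9 * p1) * (e10 * (p7 * p3))).
  by rewrite [X in X + _]expr2 H; ring.
by ring.
Qed.

(** [theta11_sq] with psi(q) = f_2^2 / f_1, cleared of denominators; the products are split by
    residues modulo 5. *)
Lemma euler_psi_identity :
  euler 2 ^+ 4 * euler 5 ^+ 2 * euler 10 =
    q * euler 10 ^+ 5 * euler 1 ^+ 2 + euler 1 * euler 2 * euler 5 ^+ 5.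
Proof.
have := theta11_sq; rewrite !jacobi_triple // !subnn !subSS !subn0 -!/(euler _).
(* The products starting at q^0 contain the factor 1 + 1 = 2; isolating it allows the common 4 to be
   cancelled below. *)
rewrite (poch_shift 1 0 (isT : 0 < 1)%N) (poch_shift 1 0 (isT : 0 < 5)%N).
have -> : euler 10 = euler 5 * poch 1 5 5 by rewrite [RHS]mulrC poch_conj.
have -> : euler 2 = euler 1 * poch 1 1 1 by rewrite [RHS]mulrC poch_conj.
have -> : poch 1 1 1 = poch 1 5 1 * poch 1 5 2 * poch 1 5 3
    * poch 1 5 4 * poch 1 5 5.
  by rewrite (@poch_split 5) // !big_ord_recr big_ord0 /= mul1r.
rewrite !addn0 expr0 mulr1.
move: (poch 1 5 1) (poch 1 5 2) (poch 1 5 3) (poch 1 5 4) (poch 1 5 5) (euler 1) (euler 5).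
move=> s1 s2 s3 s4 s5 e1 e5 H.
have {H} : (e1 * (s1 * s2 * s3 * s4 * s5) ^+ 2) ^+ 2
    = e5 ^+ 2 * (s1 * s2 * s3 * s4) + q * (e5 * s5 ^+ 2) ^+ 2.
  apply: (@mulfI _ (4 : ps)); first by rewrite ps_neq0 // coefs_nat.
  by apply: etrans (etrans _ H) _; ring.
move=> H; transitivity (e1 ^+ 2 * e5 ^+ 3 * s5
    * (e1 * (s1 * s2 * s3 * s4 * s5) ^+ 2) ^+ 2); first by ring.
by rewrite H; ring.
Qed.

(** * Hecke relations *)

Definition ps_of_poly (p : {poly int}) : ps := PS (fun n => p`_n).

Fact ps_of_poly_zmod_morphism : zmod_morphism ps_of_poly.
Proof. by move=> p r; apply: psP => n; exact: coefB. Qed.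
Fact ps_of_poly_monoid_morphism : monoid_morphism ps_of_poly.
Proof.
by split=> [|p r]; apply: psP => n; [exact: coef1|exact: coefM].
Qed.
HB.instance Definition _ := GRing.isZmodMorphism.Build
  {poly int} ps ps_of_poly ps_of_poly_zmod_morphism.
HB.instance Definition _ := GRing.isMonoidMorphism.Build
  {poly int} ps ps_of_poly ps_of_poly_monoid_morphism.

Lemma ps_of_polyX : ps_of_poly 'X = q.
Proof. by apply: psP => n; exact: coefX. Qed.

(** Sharper by one than [pprod_lim]: when factor [i] is 1 + O(q^(i+1)), [N] factors already
    determine the coefficient of q^N, as the truncations in [A5] require. *)
Lemma pprod_eqm F N k : (forall i, exists G, F i = 1 + q ^+ i.+1 * G) ->
  (k <= N)%N -> (\prod_(i < N) F i) k = pprod F k.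
Proof.
move=> F1; have step M : (k <= M)%N ->
    (\prod_(i < M.+1) F i) k = (\prod_(i < M) F i) k.
  move=> kM; rewrite big_ord_recr /=; have [G ->] := F1 M.
  rewrite mulrDr mulr1 coefsD mulrCA coefsqnM.
  by rewrite leqNgt ltnS kM addr0.
rewrite /pprod coefsE step // => /subnKC <-; move: (N - k)%N => d.
by elim: d => [|d IHd]; rewrite ?addn0 // addnS step ?leq_addr.
Qed.

Lemma f_trunc_coefs N m k : (0 < m)%N -> (k <= N)%N -> (f_trunc N m)`_k = euler m k.
Proof.
move=> m0 kN; rewrite /euler /poch -(pprod_eqm _ kN); last first.
  move=> i; exists (- q ^+ (m.-1 * i.+1)).
  by rewrite mulrN -exprD -mulSn prednK // mulrN1z mulN1r mulnS addnC.
rewrite -[LHS]/(ps_of_poly (f_trunc N m) k); congr (coefs _ k).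
rewrite /f_trunc big_add1 big_mkord rmorph_prod; apply: eq_bigr => i _.
by rewrite rmorphB rmorph1 rmorphXn /= ps_of_polyX mulnS addnC mulrN1z mulN1r.
Qed.

Lemma geom_truncE N j : (1 - 'X^j) * geom_trunc N j = 1 - 'X^(j * N.+1).
Proof.
rewrite /geom_trunc big_mkord exprM -[1 - 'X^j]opprB -[RHS]opprB [in RHS]subrX1 mulNr.
by congr (- (_ * _)); apply: eq_bigr => i _; rewrite exprM.
Qed.

(** Each [1 - 'X^j] times its truncated geometric sum is 1 modulo X^(N+1), hence so is the whole
    product. *)
Lemma invf1_trunc_mul N k : (k <= N)%N ->
  (euler 1 * ps_of_poly (invf1_trunc N)) k = (1 : ps) k.
Proof.
move=> kN.
rewrite (@eqmM N _ (ps_of_poly (f_trunc N 1)) _ (ps_of_poly (invf1_trunc N))) //.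
  rewrite -rmorphM /f_trunc /invf1_trunc -big_split /=.
  under eq_bigr => j _ do rewrite mul1n geom_truncE.
  have prod_mod M : exists p : {poly int},
      \prod_(i < M) (1 - 'X^(i.+1 * N.+1)) = 1 + 'X^(N.+1) * p.
    elim: M => [|M [p IHM]]; first by exists 0; rewrite big_ord0 mulr0 addr0.
    exists (p - 'X^(M * N.+1) - 'X^(M.+1 * N.+1) * p).
    rewrite big_ord_recr IHM /= mulSn exprD.
    by move: ('X^(N.+1)) ('X^(M * N.+1)) => x y; ring.
  rewrite big_add1 big_mkord /=; have [p ->] := prod_mod N.
  rewrite rmorphD rmorph1 rmorphM rmorphXn /= ps_of_polyX.
  by rewrite coefsD coefsqnM ltnNge kN addr0.
by move=> i iN; rewrite -(f_trunc_coefs (isT : 0 < 1)%N iN).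
Qed.

Definition inv_euler : ps := PS (fun n => (invf1_trunc n)`_n).

(** Both truncations invert [euler 1] up to degree [k], where the inverse is unique by
    [eqm_cancel]. *)
Lemma inv_euler_trunc N k : (k <= N)%N -> (invf1_trunc N)`_k = inv_euler k.
Proof.
move=> kN; have H : forall i, (i <= k)%N ->
    (euler 1 * ps_of_poly (invf1_trunc N)) i = (euler 1 * ps_of_poly (invf1_trunc k)) i.
  by move=> i ik; rewrite !invf1_trunc_mul // (leq_trans ik).
by have := eqm_cancel (euler0 (isT : 0 < 1)%N) H (leqnn k).
Qed.

Lemma mul_euler_inv : euler 1 * inv_euler = 1.
Proof.
apply: psP => n; rewrite -(invf1_trunc_mul (leqnn n)).
by apply: eqmM (leqnn n) => // i ni; rewrite -(inv_euler_trunc ni).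
Qed.

(* Locked so that multiplicativity lemmas do not unfold the products. *)
Definition pairgf : ps := locked (q ^+ 2 * euler 5 ^+ 10 * inv_euler ^+ 2).
Definition cusp : ps := locked (q * euler 1 ^+ 4 * euler 5 ^+ 4).
Definition haupt : ps :=
  locked (q * euler 2 * euler 10 ^+ 3 * inv_euler ^+ 3 * dil 5 inv_euler).

(** The shift by 2 turns the index 2^(k+1) n + 3 2^k - 2 into 2^k (2n + 3), a power of 2 times an
    odd number. *)
Lemma coefs_pairgf n : pairgf n.+2 = A5 n.
Proof.
rewrite /pairgf -lock -mulrA coefsqnM subn2 /= /A5.
rewrite -[RHS]/(ps_of_poly _ n) rmorphM !rmorphXn /=.
have eqmX (f f' : ps) m : (forall k, (k <= n)%N -> f k = f' k) ->
    forall k, (k <= n)%N -> (f ^+ m) k = (f' ^+ m) k.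
  by move=> ff'; elim: m => // m IHm; rewrite !exprS; apply: eqmM.
apply: eqmM (leqnn n); apply: eqmX => k kn.
  by rewrite -(@f_trunc_coefs n).
by rewrite -(@inv_euler_trunc n).
Qed.

(** * Eta quotients as rational functions of the Hauptmodul *)

Section EtaQuotients.
Variables (F : fieldType) (Q e1 e2 e5 e10 : F).
Hypotheses (e1_0 : e1 != 0) (e2_0 : e2 != 0).
Hypotheses (e5_0 : e5 != 0) (e10_0 : e10 != 0).
Hypothesis phi_id :
  e5 ^+ 5 * e2 ^+ 2 = e1 ^+ 4 * e10 ^+ 2 * e5 + 4 * Q * e1 * e2 * e10 ^+ 5.
Hypothesis psi_id :
  e2 ^+ 4 * e5 ^+ 2 * e10 = Q * e10 ^+ 5 * e1 ^+ 2 + e1 * e2 * e5 ^+ 5.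

Let T := Q * e2 * e10 ^+ 3 * e1^-1 ^+ 3 * e5^-1.
Let C := Q * e1 ^+ 4 * e5 ^+ 4.
Let C2 := Q ^+ 2 * e2 ^+ 4 * e10 ^+ 4.
Let G := Q ^+ 2 * e5 ^+ 10 * e1^-1 ^+ 2.
Let G2 := Q ^+ 4 * e10 ^+ 10 * e2^-1 ^+ 2.

Lemma eta_u : 1 + 4 * T = e2 ^+ 2 * e5 ^+ 4 / (e1 ^+ 4 * e10 ^+ 2).
Proof.
transitivity (e5 ^+ 5 * e2 ^+ 2 / (e1 ^+ 4 * e10 ^+ 2 * e5)).
  by rewrite phi_id /T; field; rewrite e1_0 e5_0 e10_0.
by field; rewrite e1_0 e5_0 e10_0.
Qed.

(** Over a common denominator, [T] added to [eta_u] has [e2] times the right side of [psi_id] as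
    numerator. *)
Lemma eta_v : 1 + 5 * T = e2 ^+ 5 * e5 / (e1 ^+ 5 * e10).
Proof.
have -> : 1 + 5 * T = 1 + 4 * T + T by ring.
transitivity (e2 ^+ 4 * e5 ^+ 2 * e10 * e2 / (e1 ^+ 5 * e5 * e10 ^+ 2)).
  by rewrite eta_u psi_id /T; field; rewrite e1_0 e5_0 e10_0.
by field; rewrite e1_0 e5_0 e10_0.
Qed.

(** As T, 1 + 4T and 1 + 5T are monomials in [Q] and the [e]'s, each relation compares two
    monomials. The first two express the Hauptmodul q f_5^6 / f_1^6 of Gamma_0(5), at q^2 and at q,
    through T. *)
Lemma eta_relations :
  [/\ T ^+ 2 * (1 + 4 * T) * e2 ^+ 6 = Q ^+ 2 * e10 ^+ 6 * (1 + 5 * T) ^+ 2,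
      T * (1 + 4 * T) ^+ 2 * e1 ^+ 6 = Q * e5 ^+ 6 * (1 + 5 * T)
    & C * T * (1 + 5 * T) = C2 * (1 + 4 * T)] /\
  [/\ G * (1 + 5 * T) ^+ 2 = C2 * (1 + 4 * T) ^+ 3,
      G * (1 + 5 * T) = C * T * (1 + 4 * T) ^+ 2
    & G2 * (1 + 5 * T) = C * T ^+ 3].
Proof.
rewrite eta_u eta_v /T /C /C2 /G /G2.
by do 2 split; field; rewrite ?e1_0 ?e2_0 ?e5_0 ?e10_0.
Qed.

End EtaQuotients.

Lemma euler_neq0 m : (0 < m)%N -> euler m != 0.
Proof. by move=> m0; rewrite ps_neq0 // euler0. Qed.

(** The relations are free of divisions, so they descend from [{fraction ps}] by injectivity of
    [tofrac]. *)
Lemma ps_eta_relations :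
  [/\ haupt ^+ 2 * (1 + 4 * haupt) * euler 2 ^+ 6 =
        q ^+ 2 * euler 10 ^+ 6 * (1 + 5 * haupt) ^+ 2,
      haupt * (1 + 4 * haupt) ^+ 2 * euler 1 ^+ 6 = q * euler 5 ^+ 6 * (1 + 5 * haupt)
    & cusp * haupt * (1 + 5 * haupt) = dil 2 cusp * (1 + 4 * haupt)] /\
  [/\ pairgf * (1 + 5 * haupt) ^+ 2 = dil 2 cusp * (1 + 4 * haupt) ^+ 3,
      pairgf * (1 + 5 * haupt) = cusp * haupt * (1 + 4 * haupt) ^+ 2
    & dil 2 pairgf * (1 + 5 * haupt) = cusp * haupt ^+ 3].
Proof.
have n0 (f : ps) : f != 0 -> tofrac f != 0 by move=> ?; rewrite tofrac_eq0.
have inv m : (0 < m)%N -> tofrac (dil m inv_euler) = (tofrac (euler m))^-1.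
  move=> m0; apply: (@mulfI {fraction ps} (tofrac (euler m)));
    first exact: n0 (euler_neq0 m0).
  rewrite mulfV; last exact: n0 (euler_neq0 m0).
  by rewrite -tofracM -{1}[m]muln1 -dil_euler // -rmorphM mul_euler_inv !rmorph1.
have phi := congr1 (@tofrac ps) euler_phi_identity.
have psi := congr1 (@tofrac ps) euler_psi_identity.
rewrite !(rmorphXn, rmorph_nat, rmorphD, rmorphM) /= in phi psi.
have tinj : injective (@tofrac ps).
  by move=> x y /eqP; rewrite tofrac_eq => /eqP.
have tE : tofrac haupt = tofrac q * tofrac (euler 2) * tofrac (euler 10) ^+ 3
    * (tofrac (euler 1))^-1 ^+ 3 * (tofrac (euler 5))^-1.
  by rewrite /haupt -lock !(rmorphXn, rmorphM) /= inv // -[inv_euler in LHS]dil1 inv.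
have cE : tofrac cusp = tofrac q * tofrac (euler 1) ^+ 4 * tofrac (euler 5) ^+ 4.
  by rewrite /cusp -lock !(rmorphXn, rmorphM).
have c2E : tofrac (dil 2 cusp) =
    tofrac q ^+ 2 * tofrac (euler 2) ^+ 4 * tofrac (euler 10) ^+ 4.
  by rewrite /cusp -lock !(rmorphXn, rmorphM) /= dilq // !dil_euler // rmorphXn.
have gE : tofrac pairgf =
    tofrac q ^+ 2 * tofrac (euler 5) ^+ 10 * (tofrac (euler 1))^-1 ^+ 2.
  by rewrite /pairgf -lock !(rmorphXn, rmorphM) /= -[inv_euler in LHS]dil1 inv.
have g2E : tofrac (dil 2 pairgf) =
    tofrac q ^+ 4 * tofrac (euler 10) ^+ 10 * (tofrac (euler 2))^-1 ^+ 2.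
  by rewrite /pairgf -lock !(rmorphXn, rmorphM) /= dilq // !dil_euler // inv //
    rmorphXn -exprM.
have [[h1 h2 h3] [h4 h5 h6]] := eta_relations
  (n0 _ (euler_neq0 (isT : 0 < 1)%N)) (n0 _ (euler_neq0 (isT : 0 < 2)%N))
  (n0 _ (euler_neq0 (isT : 0 < 5)%N)) (n0 _ (euler_neq0 (isT : 0 < 10)%N)) phi psi.
by split; split; apply: tinj;
  rewrite !(rmorph1, rmorph_nat, rmorphXn, rmorphD, rmorphM) /= ?tE ?cE ?c2E ?gE ?g2E.
Qed.

(** * The conjugates t(q), t(-q) and the operator U *)

Lemma haupt0 : haupt 0%N = 0.
Proof. by rewrite /haupt -lock -!mulrA coefsqM. Qed.

Lemma inv_euler0 : inv_euler 0%N = 1.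
Proof.
by have := congr1 (fun f : ps => f 0%N) mul_euler_inv;
  rewrite coefsM0 euler0 // mul1r.
Qed.

Lemma haupt1 : haupt 1%N = 1.
Proof.
rewrite /haupt -lock -!mulrA coefsqM !coefsM0 !euler0 //.
by rewrite dil0 inv_euler0.
Qed.

(* With t = haupt, the degree-3 cover X_0(10) -> X_0(5) gives a cubic equation over
   Q(t(q^2)) with roots t(q), t(-q) and -(1 + 4 t(q^2)) / (4 (1 + 5 t(q^2))); the last
   one splits off. *)
Lemma haupt_quadratic : let T := dil 2 haupt in
  haupt ^+ 2 = 2 * T * (3 + 10 * T) * haupt + T * (1 + 4 * T).
Proof.
move=> T; have [[h1 h2 _] _] := ps_eta_relations.
have {h2} := congr1 (dil 2) h2.
rewrite !(rmorph1, rmorph_nat, rmorphXn, rmorphD, rmorphM) /= dilq // !dil_euler // -/T.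
move=> h2.
(* [h1] and [h2], the latter now at q^2, both evaluate q^2 f_10^6 / f_2^6; eliminating it leaves
   this cubic. *)
have cubic : haupt ^+ 2 * (1 + 4 * haupt) * (1 + 5 * T)
    = T * (1 + 4 * T) ^+ 2 * (1 + 5 * haupt) ^+ 2.
  apply: (@mulfI _ (euler 2 ^+ 6)); first by rewrite expf_neq0 // euler_neq0.
  transitivity (haupt ^+ 2 * (1 + 4 * haupt) * euler 2 ^+ 6 * (1 + 5 * T));
    first by ring.
  rewrite h1.
  transitivity (q ^+ 2 * euler 10 ^+ 6 * (1 + 5 * T) * (1 + 5 * haupt) ^+ 2);
    first by ring.
  by rewrite -h2; ring.
apply/eqP; rewrite -subr_eq0; apply/eqP.
(* The linear factor of the third root; its constant term is 1, so it can be cancelled. *)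
apply: (@mulfI _ (4 * (1 + 5 * T) * haupt + (1 + 4 * T))).
  apply: ps_neq0; rewrite !(coefsD, coefsM0) haupt0 mulr0 add0r coefs1 /T coefs_dil.
  by rewrite dvdn0 div0n haupt0 mulr0.
rewrite mulr0.
by apply: etrans (etrans _ (subrr (haupt ^+ 2 * (1 + 4 * haupt) * (1 + 5 * T))));
  [|rewrite {2}cubic; reflexivity]; ring.
Qed.

Lemma flip_dil2 f : flip (dil 2 f) = dil 2 f.
Proof. exact: (flip_dil 1). Qed.

(** Vieta's formulas: t(-q) satisfies the same quadratic, whose coefficients are series in q^2, and
    differs from t(q) because the coefficient of q in t is 1. *)
Lemma haupt_flip : let T := dil 2 haupt in
  haupt + flip haupt = 2 * T * (3 + 10 * T) /\
  haupt * flip haupt = - (T * (1 + 4 * T)).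
Proof.
move=> T; have h := haupt_quadratic; rewrite -/T in h.
have := congr1 flip h.
rewrite !(rmorph1, rmorph_nat, rmorphXn, rmorphD, rmorphM) /= flip_dil2 -/T => h'.
have S : haupt + flip haupt = 2 * T * (3 + 10 * T).
  apply: (@mulfI _ (haupt - flip haupt)).
    apply/eqP => /(congr1 (fun f : ps => f 1%N)).
    by rewrite coefsB coefs_flip haupt1.
  transitivity (haupt ^+ 2 - flip haupt ^+ 2); first by ring.
  by rewrite h h'; ring.
split=> //; have -> : flip haupt = 2 * T * (3 + 10 * T) - haupt by rewrite -S; ring.
by rewrite mulrBr -[haupt * haupt]expr2 h; ring.
Qed.

Lemma evens_cusp : evens cusp = - (4 * cusp + 8 * dil 2 cusp).
Proof.
have [[_ _ h3] _] := ps_eta_relations; have [S P] := haupt_flip.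
set T := dil 2 haupt in S P.
have h3' := congr1 flip h3; have h4 := congr1 (dil 2) h3.
rewrite !(rmorph1, rmorph_nat, rmorphXn, rmorphD, rmorphM) /= ?flip_dil2 in h3' h4.
rewrite -/T in h4.
have T0 : T != 0.
  by apply/eqP => /(congr1 (fun f : ps => f 2%N)); rewrite coefs_dil /= haupt1.
have V : (1 + 5 * haupt) * (1 + 5 * flip haupt) = 1 + 5 * T.
  transitivity (1 + 5 * (haupt + flip haupt) + 25 * (haupt * flip haupt));
    first by ring.
  by rewrite S P; ring.
have n1 m : 1 + m%:R * T != 0.
  apply: ps_neq0; rewrite coefsD coefsM0 coefs1 /T coefs_dil dvdn0 div0n haupt0.
  by rewrite mulr0.
apply: (@dil_inj 2) => //; apply: (@mulfI _ (2 : ps)).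
  by rewrite ps_neq0 // coefs_nat.
rewrite evens_dil !(rmorph1, rmorph_nat, rmorphXn, rmorphN, rmorphD, rmorphM) /=.
(* By [P] and [V] this multiplier is minus the product of t(1 + 5t) over both conjugates, which
   clears the denominators in [h3] and [h3']. *)
apply: (@mulfI _ (T * (1 + 4 * T) * (1 + 5 * T))).
  by rewrite !mulf_neq0 ?n1.
transitivity (- (cusp * haupt * (1 + 5 * haupt) * (flip haupt * (1 + 5 * flip haupt))
    + flip cusp * flip haupt * (1 + 5 * flip haupt) * (haupt * (1 + 5 * haupt)))).
  transitivity (- (haupt * flip haupt) * ((1 + 5 * haupt) * (1 + 5 * flip haupt))
    * (cusp + flip cusp)).
    by rewrite P V; ring.
  by ring.
rewrite h3 h3'.
transitivity (- (dil 2 cusp * ((haupt + flip haupt) + 8 * (haupt * flip haupt)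
   + 5 * ((haupt + flip haupt) ^+ 2 - 2 * (haupt * flip haupt))
   + 20 * (haupt * flip haupt) * (haupt + flip haupt)))).
  by ring.
rewrite S P.
(* Grouped so that [h4] turns the last product into a multiple of [dil 2 (dil 2 cusp)]. *)
transitivity (- (8 * dil 2 cusp * (T * (1 + 4 * T) * (1 + 5 * T))
   + 16 * T * (1 + 5 * T) * (dil 2 cusp * T * (1 + 5 * T)))); first by ring.
by rewrite h4; ring.
Qed.

Lemma evens_pairgf : evens pairgf = 9 * pairgf + cusp - 8 * dil 2 pairgf.
Proof.
have [_ [k1 k2 k3]] := ps_eta_relations; have [S P] := haupt_flip.
set T := dil 2 haupt in S P.
have k1' := congr1 flip k1; have k4 := congr1 (dil 2) k2; have k5 := congr1 (dil 2) k3.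
rewrite !(rmorph1, rmorph_nat, rmorphXn, rmorphD, rmorphM) /= ?flip_dil2 in k1' k4 k5.
rewrite -/T in k4 k5.
have V : (1 + 5 * haupt) * (1 + 5 * flip haupt) = 1 + 5 * T.
  transitivity (1 + 5 * (haupt + flip haupt) + 25 * (haupt * flip haupt));
    first by ring.
  by rewrite S P; ring.
have n1 m : 1 + m%:R * T != 0.
  apply: ps_neq0; rewrite coefsD coefsM0 coefs1 /T coefs_dil dvdn0 div0n haupt0.
  by rewrite mulr0.
apply: (@dil_inj 2) => //; apply: (@mulfI _ (2 : ps)).
  by rewrite ps_neq0 // coefs_nat.
rewrite evens_dil !(rmorph1, rmorph_nat, rmorphXn, rmorphB, rmorphD, rmorphM) /=.
(* The square clears the denominators in [k1] and [k1']. With u = 1 + 4t one has 4(1 + 5t) = 5u - 1,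
   so the 16 makes everything an integral polynomial in the two values of u. *)
apply: (@mulfI _ (16 * (1 + 5 * T) ^+ 2)).
  by rewrite mulf_neq0 ?expf_neq0 ?n1 // ps_neq0 // coefs_nat.
rewrite -{1}V.
transitivity (16 * (pairgf * (1 + 5 * haupt) ^+ 2 * (1 + 5 * flip haupt) ^+ 2
    + flip pairgf * (1 + 5 * flip haupt) ^+ 2 * (1 + 5 * haupt) ^+ 2)); first by ring.
rewrite k1 k1'.
(* s and p are the sum and the product of 1 + 4 haupt and its flip. *)
pose s := 2 + 4 * (haupt + flip haupt).
pose p := 1 + 4 * (haupt + flip haupt) + 16 * (haupt * flip haupt).
transitivity (dil 2 cusp * (25 * p ^+ 2 * s - 10 * p * (s ^+ 2 - 2 * p)
    + s ^+ 3 - 3 * p * s)); first by rewrite /s /p; ring.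
rewrite /s /p S P.
(* The coefficients 9, 1, -8 of the claim appear; [k4] and [k5] identify the outer terms with V and
   V^2 of [pairgf]. *)
transitivity (32 * (1 + 5 * T) * (9 * (dil 2 cusp * T * (1 + 4 * T) ^+ 2)
   + dil 2 cusp * (1 + 5 * T) - 8 * (dil 2 cusp * T ^+ 3))); first by ring.
by rewrite -k4 -k5; ring.
Qed.

(** * The recursion *)

Lemma pairgf_double n :
  pairgf (n.*2) = 9 * pairgf n + cusp n - 8 * (if odd n then 0 else pairgf n./2).
Proof.
rewrite -coefs_evens evens_pairgf coefsB coefsD !coefsMnat coefs_dil dvdn2 divn2.
by case: odd.
Qed.

Lemma cusp_double n :
  cusp (n.*2) = - (4 * cusp n + 8 * (if odd n then 0 else cusp n./2)).
Proof.
rewrite -coefs_evens evens_cusp coefsN coefsD !coefsMnat coefs_dil dvdn2 divn2.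
by case: odd.
Qed.

(** The sum 1 + 8 + ... + 8^k, written as in the theorem so that the two are convertible. *)
Definition geom8 k : int := ((8 ^ k.+1 - 1) %/ 7)%N%:Z.

Lemma geom8E k : 7 * geom8 k = 8 ^+ k.+1 - 1.
Proof.
have [m m8] : exists m, (8 ^ k.+1 = 7 * m + 1)%N.
  elim: k => [|k [m IHk]]; first by exists 1%N.
  by exists (8 * m + 1)%N; rewrite expnS IHk; lia.
rewrite /geom8 m8 addnK mulKn // -[8 ^+ _]natrX m8; lia.
Qed.

Lemma geom8S k : geom8 k.+1 = 8 * geom8 k + 1.
Proof. by have := geom8E k; have := geom8E k.+1; rewrite [8 ^+ k.+2]exprS; lia. Qed.

Arguments B : simpl never.

Lemma B_rec k : B k.+2 = -4 * B k.+1 - 8 * B k + geom8 k.+1.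
Proof. by []. Qed.

(** For odd [N] the V terms vanish at the first doubling. With g = [geom8], g(k+2) + 4 g(k+1) + 8
    g(k) = 13 g(k+1), so g - 13 B solves the homogeneous recursion of [cusp]. *)
Lemma pairgf_pow2 N k : odd N ->
  pairgf (2 ^ k * N)%N = B k * cusp N + geom8 k * pairgf N /\
  cusp (2 ^ k * N)%N = (geom8 k - 13 * B k) * cusp N.
Proof.
move=> oN; pose P k := pairgf (2 ^ k * N)%N = B k * cusp N + geom8 k * pairgf N /\
  cusp (2 ^ k * N)%N = (geom8 k - 13 * B k) * cusp N.
suff [] : P k /\ P k.+1 by [].
have dbl j : (2 ^ j.+1 * N = (2 ^ j * N).*2)%N by rewrite expnS -mulnA mul2n.
have g0 : geom8 0 = 1 by [].
elim: k => [|k [[gk ck] [gk1 ck1]]].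
  rewrite /P dbl geom8S expn0 mul1n pairgf_double cusp_double oN g0 /=.
  by split; split; ring.
split=> //; rewrite /P dbl pairgf_double cusp_double.
rewrite {2 4}dbl dbl !doubleK odd_double /= -dbl gk ck gk1 ck1 B_rec !geom8S.
by split; ring.
Qed.

(** The recursion of g - 13 B has characteristic roots -2 + 2i and -2 - 2i, with fourth power -64,
    and its value at 3 is 0; hence 13 B = g at every index 4m + 3. *)
Lemma B_4m3 m : 91 * B (4 * m + 3) = 8 ^+ (4 * m + 4) - 1.
Proof.
(* At index 4m + 4 the sequence g - 13 B equals (-64)^(m+1), and 448 = 7 * 64. The induction needs
   two consecutive values. *)
suff [] : 91 * B (4 * m + 3) = 8 ^+ (4 * m + 4) - 1 /\
    91 * B (4 * m + 4) = 8 ^+ (4 * m + 5) - 1 + 448 * (- 64) ^+ m by [].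
elim: m => [|m [IH3 IH4]]; first by [].
have -> : (4 * m.+1 + 3 = (4 * m + 3).+4)%N by lia.
have -> : (4 * m.+1 + 4 = (4 * m + 3).+4.+1)%N by lia.
have -> : (4 * m.+1 + 5 = (4 * m + 3).+4.+2)%N by lia.
have E4 : (4 * m + 4 = (4 * m + 3).+1)%N by lia.
have E5 : (4 * m + 5 = (4 * m + 3).+2)%N by lia.
rewrite E4 E5 in IH3 IH4; move: (4 * m + 3)%N IH3 IH4 => k IH3 IH4 {E4 E5}.
have := B_rec k; have := B_rec k.+1; have := B_rec k.+2; have := B_rec k.+3.
rewrite !geom8S; have := geom8E k; move: IH3 IH4; rewrite !exprS.
move: (B k) (B k.+1) (B k.+2) (B k.+3) (B k.+4) (B k.+4.+1) (geom8 k)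
  (8 ^+ k) ((-64) ^+ m).
move=> b0 b1 b2 b3 b4 b5 s e f; lia.
Qed.

Theorem theorem1p2 :
  (forall n k : nat, (1 <= k)%N ->
     A5 (2 ^ k.+1 * n + 3 * 2 ^ k - 2)%N =
       B k * A5 (4 * n + 4)%N
       + ((((8 ^ k.+1 - 1) %/ 7)%N)%:Z - 9 * B k) * A5 (2 * n + 1)%N)
  /\
  (forall m n : nat,
     (((((8 ^ (4 * m + 4) - 1) %/ 91)%N)%:Z) %| A5 (2 ^ (4 * m + 4) * n + 3 * 2 ^ (4 * m + 3) - 2)%N)%Z).
Proof.
have main n k : (1 <= k)%N ->
     A5 (2 ^ k.+1 * n + 3 * 2 ^ k - 2)%N =
       B k * A5 (4 * n + 4)%N
       + (geom8 k - 9 * B k) * A5 (2 * n + 1)%N.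
  move=> k1; rewrite -!coefs_pairgf.
  have oN : odd (2 * n + 3) by rewrite oddD mul2n odd_double.
  have -> : (2 ^ k.+1 * n + 3 * 2 ^ k - 2).+2 = (2 ^ k * (2 * n + 3))%N.
    have : (2 <= 2 ^ k)%N by rewrite -{1}[2%N]expn1 leq_exp2l.
    by rewrite expnS; move: (2 ^ k)%N => p p2; nia.
  have -> : (4 * n + 4).+2 = (2 * n + 3).*2 by lia.
  have -> : (2 * n + 1).+2 = (2 * n + 3)%N by lia.
  (* For odd N, [cusp N] is [pairgf N.*2 - 9 * pairgf N], which eliminates the cusp form. *)
  by rewrite (pairgf_pow2 k oN).1 pairgf_double oN; ring.
split=> [|m n]; first exact: main.
have B91 := B_4m3 m.
have E4 : (4 * m + 4 = (4 * m + 3).+1)%N by lia.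
rewrite E4 in B91 *; rewrite main; last by lia.
have := geom8E (4 * m + 3).
rewrite -B91 => g7.
(* The second coefficient becomes 13 B - 9 B = 4 B, so both terms are multiples of B, which is the
   stated divisor. *)
have -> : geom8 (4 * m + 3) = 13 * B (4 * m + 3) by lia.
have -> : ((8 ^ (4 * m + 3).+1 - 1) %/ 91)%N%:Z = B (4 * m + 3).
  have p8 : (0 < 8 ^ (4 * m + 3).+1)%N by rewrite expn_gt0.
  have : 91 * B (4 * m + 3) = (8 ^ (4 * m + 3).+1 - 1)%N%:Z.
    by rewrite B91 -subzn // -[8 ^+ _]natrX natz.
  move: (B _) (_ - 1)%N => b d.
  case: b => [b|b] h; last by lia.
  have -> : d = (91 * b)%N by lia.
  by rewrite mulKn.
apply/dvdzP; exists (A5 (4 * n + 4) + 4 * A5 (2 * n + 1)); ring.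
Qed.
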